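(* Let $X_1,X_2,\ldots,X_n$ be real Banach spaces and let $X$ be their $\ell_1$-sum (or their $\ell_\infty$-sum). Then $X$ is nicely smooth if and only if $X_i$ is nicely smooth for every $i=1,\ldots,n$.
   Context: All Banach spaces are real. The $\ell_1$-sum (respectively $\ell_\infty$-sum) of $X_1,\ldots,X_n$ is $X_1\times\cdots\times X_n$ with norm $\sum_i\|x_i\|$ (respectively $\max_i\|x_i\|$). A set $A\subseteq B(X^* )$ (closed unit ball of $X^*$) is a norming set for $X$ if $\|x\|=\sup\{x^*(x):x^*\in A\}$ for all $x\in X$. A closed subspace $F\subseteq X^*$ is a norming subspace if its closed unit ball $B(F)$ is a norming set for $X$. $X$ is nicely smooth if $X^*$ contains no proper norming (closed) subspace. *)

(* Defs.v *)
From HB Require Import structures.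
From mathcomp Require Import all_boot all_order all_algebra.
From mathcomp Require Import all_classical all_reals all_analysis.

Set Implicit Arguments.
Unset Strict Implicit.
Unset Printing Implicit Defensive.

Import Order.TTheory GRing.Theory Num.Theory.
Import numFieldNormedType.Exports.

Local Open Scope classical_set_scope.
Local Open Scope ring_scope.

(* The topological dual X^*: continuous linear functionals, with pointwise
   operations and the operator norm. *)
Section Dual.
Context {R : realType} (X : normedModType R).

Definition dual_pred : {pred X -> R^o} :=
  mem [set f : X -> R^o | linear f /\ continuous f].

Lemma dual_predP (f : X -> R^o) :
  reflect (linear f /\ continuous f) (f \in dual_pred).
Proof. by apply: (iffP idP); rewrite inE. Qed.

Lemma dual_pred_submod : submod_closed dual_pred.
Proof.
split=> [|a f g /dual_predP[lf cf] /dual_predP[lg cg]]; apply/dual_predP.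
  by split=> [a x y|x]; [rewrite /= scaler0 addr0|exact: cst_continuous].
split=> [b x y|x].
  rewrite !fctE /= lf lg !scalerDr !scalerA (mulrC a) -!addrA.
  by congr (_ + _); rewrite addrCA.
apply: (@continuousD _ _ _ (a *: f) g x) => //; last exact: cg.
by apply: (@continuousZl_tmp _ _ _ f a x); exact: cf.
Qed.

HB.instance Definition _ :=
  GRing.isSubmodClosed.Build R (X -> R^o) dual_pred dual_pred_submod.

Record dual := Dual { dual_fun :> X -> R^o ; _ : dual_fun \in dual_pred }.

HB.instance Definition _ := [isSub for dual_fun].
HB.instance Definition _ := [Choice of dual by <:].
HB.instance Definition _ := [SubChoice_isSubLmodule of dual by <:].

Lemma dual_linear (f : dual) : linear f.
Proof. by case: f => f /= /dual_predP[]. Qed.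

Lemma dual_continuous (f : dual) : continuous (f : X -> R^o).
Proof. by case: f => f /= /dual_predP[]. Qed.

HB.instance Definition _ (f : dual) :=
  GRing.isLinear.Build R X R^o *:%R (f : X -> R^o) (@dual_linear f).

Definition dual_norm (f : dual) : R := sup [set `|f x| | x in [set x | `|x| <= 1]].

Lemma dual_norm_has_sup (f : dual) :
  has_sup [set `|f x| | x in [set x : X | `|x| <= 1]].
Proof.
split; first by exists `|f 0|, 0 => //=; rewrite normr0.
have /linear_boundedP/pinfty_ex_gt0[M M0 Mf] :=
  continuous_linear_bounded 0 (@dual_continuous f 0).
exists M => _ [x /= x1 <-]; apply: (le_trans (Mf x)).
by rewrite -[leRHS]mulr1 ler_wpM2l // ltW.
Qed.

Lemma le_dual_norm1 (f : dual) x : `|x| <= 1 -> `|f x| <= dual_norm f.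
Proof. by move=> x1; apply: (ub_le_sup (dual_norm_has_sup f).2); exists x. Qed.

Lemma dual_norm_le (f : dual) M :
  (forall x, `|x| <= 1 -> `|f x| <= M) -> dual_norm f <= M.
Proof.
by move=> fM; apply: ge_sup (dual_norm_has_sup f).1 _ => _ [x /= /fM ? <-].
Qed.

Lemma dualD (f g : dual) x : (f + g) x = f x + g x. Proof. by []. Qed.

Lemma dualZ a (f : dual) x : (a *: f) x = a * f x. Proof. by []. Qed.

Lemma le_dual_norm (f : dual) x : `|f x| <= dual_norm f * `|x|.
Proof.
have [->|x0] := eqVneq x 0; first by rewrite linear0 !normr0 mulr0.
have x_gt0 : 0 < `|x| by rewrite normr_gt0.
rewrite -ler_pdivrMr // mulrC -[_^-1]gtr0_norm ?invr_gt0 // -normrM.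
rewrite -[_ * _]/(`|x|^-1 *: f x) -linearZ le_dual_norm1 //.
by rewrite normrZ normfV normr_id mulVf // normr_eq0.
Qed.

Let ler_dual_normD (f g : dual) : dual_norm (f + g) <= dual_norm f + dual_norm g.
Proof.
apply: dual_norm_le => x x1.
by rewrite dualD (le_trans (ler_normD _ _)) // lerD // le_dual_norm1.
Qed.

Let dual_norm_ge0 (f : dual) : 0 <= dual_norm f.
Proof. by apply: le_trans (@le_dual_norm1 f 0 _); rewrite // normr0. Qed.

Let dual_normZ a (f : dual) : dual_norm (a *: f) = `|a| * dual_norm f.
Proof.
have le b g : dual_norm (b *: g) <= `|b| * dual_norm g.
  by apply: dual_norm_le => x x1; rewrite dualZ normrM ler_wpM2l // le_dual_norm1.
apply/eqP; rewrite eq_le le /=; have [->|a0] := eqVneq a 0.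
  by rewrite normr0 mul0r.
by rewrite -ler_pdivlMl ?normr_gt0 // -normfV -{1}[f](scalerK a0).
Qed.

Let dual_norm_eq0 (f : dual) : dual_norm f = 0 -> f = 0.
Proof.
move=> f0; apply/val_inj/funext => x; apply/normr0_eq0/le_anti.
by rewrite normr_ge0 andbT (le_trans (le_dual_norm f x)) // f0 mul0r.
Qed.

HB.instance Definition _ :=
  Lmodule_isNormed.Build R dual ler_dual_normD dual_normZ dual_norm_eq0.

End Dual.

Section Norming.
Context {R : realType} (X : normedModType R).

Definition dual_unit_ball : set (dual X) := [set f | `|f| <= 1].

(* The supremum is taken in the extended reals, so that sup set0 = -oo. *)
Definition norming_set (A : set (dual X)) : Prop :=
  A `<=` dual_unit_ball /\
  forall x : X, (`|x|)%:E = ereal_sup [set (f x)%:E | f in A].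

Definition closed_subspace (F : set (dual X)) : Prop :=
  submod_closed (mem F) /\ closed F.

Definition norming_subspace (F : set (dual X)) : Prop :=
  closed_subspace F /\ norming_set (F `&` dual_unit_ball).

End Norming.

Definition nicely_smooth {R : realType} (X : completeNormedModType R) : Prop :=
  ~ exists F : set (dual X), norming_subspace F /\ F `<` setT.

(* Finite products of vector spaces, without a norm: the two sums below have
   this carrier and differ by their norms. *)
Section FinProd.
Context {R : realType} {n : nat}.

Definition fin_prod (X : 'I_n -> lmodType R) := {dffun forall i, X i}.

Variable X : 'I_n -> lmodType R.

HB.instance Definition _ := Choice.on (fin_prod X).

Implicit Types x y z : fin_prod X.

Definition fin_prod_add x y : fin_prod X := [ffun i => x i + y i].
Definition fin_prod_opp x : fin_prod X := [ffun i => - x i].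
Definition fin_prod_zero : fin_prod X := [ffun i => 0].
Definition fin_prod_scale (a : R) x : fin_prod X := [ffun i => a *: x i].

Let addA : associative fin_prod_add.
Proof. by move=> x y z; apply/ffunP => i; rewrite !ffunE addrA. Qed.
Let addC : commutative fin_prod_add.
Proof. by move=> x y; apply/ffunP => i; rewrite !ffunE addrC. Qed.
Let add0 : left_id fin_prod_zero fin_prod_add.
Proof. by move=> x; apply/ffunP => i; rewrite !ffunE add0r. Qed.
Let addN : left_inverse fin_prod_zero fin_prod_opp fin_prod_add.
Proof. by move=> x; apply/ffunP => i; rewrite !ffunE addNr. Qed.

HB.instance Definition _ := GRing.isZmodule.Build (fin_prod X) addA addC add0 addN.

Let scaleA a b x :
  fin_prod_scale a (fin_prod_scale b x) = fin_prod_scale (a * b) x.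
Proof. by apply/ffunP => i; rewrite !ffunE scalerA. Qed.
Let scale1 : left_id 1 fin_prod_scale.
Proof. by move=> x; apply/ffunP => i; rewrite !ffunE scale1r. Qed.
Let scaleDr : right_distributive fin_prod_scale +%R.
Proof. by move=> a x y; apply/ffunP => i; rewrite !ffunE scalerDr. Qed.
Let scaleDl x : {morph fin_prod_scale^~ x : a b / a + b}.
Proof. by move=> a b; apply/ffunP => i; rewrite !ffunE scalerDl. Qed.

HB.instance Definition _ :=
  GRing.Zmodule_isLmodule.Build R (fin_prod X) scaleA scale1 scaleDr scaleDl.

Lemma fin_prodD x y i : (x + y) i = x i + y i. Proof. exact: ffunE. Qed.
Lemma fin_prodN x i : (- x) i = - x i. Proof. exact: ffunE. Qed.
Lemma fin_prodZ a x i : (a *: x) i = a *: x i. Proof. exact: ffunE. Qed.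
Lemma fin_prod0 i : (0 : fin_prod X) i = 0. Proof. exact: ffunE. Qed.

End FinProd.

Section Sums.
Context {R : realType} {n : nat} (X : 'I_n -> normedModType R).

Definition l1_sum := fin_prod (fun i => X i).
Definition linf_sum := fin_prod (fun i => X i).

HB.instance Definition _ := GRing.Lmodule.on l1_sum.
HB.instance Definition _ := GRing.Lmodule.on linf_sum.

Definition l1_norm (x : l1_sum) : R := \sum_i `|x i|.
Definition linf_norm (x : linf_sum) : R := \big[Num.max/0]_i `|x i|.

Let l1_normD (x y : l1_sum) : l1_norm (x + y) <= l1_norm x + l1_norm y.
Proof.
rewrite /l1_norm -big_split; apply: ler_sum => i _.
by rewrite fin_prodD ler_normD.
Qed.

Let l1_normZ a (x : l1_sum) : l1_norm (a *: x) = `|a| * l1_norm x.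
Proof.
by rewrite /l1_norm mulr_sumr; apply: eq_bigr => i _; rewrite fin_prodZ normrZ.
Qed.

Lemma le_l1_norm (x : l1_sum) i : `|x i| <= l1_norm x.
Proof. by rewrite /l1_norm (bigD1 i) //= lerDl sumr_ge0. Qed.

Let l1_norm_eq0 (x : l1_sum) : l1_norm x = 0 -> x = 0.
Proof.
move=> x0; apply/ffunP => i; rewrite fin_prod0; apply/normr0_eq0/le_anti.
by rewrite normr_ge0 andbT -x0 le_l1_norm.
Qed.

HB.instance Definition _ :=
  Lmodule_isNormed.Build R l1_sum l1_normD l1_normZ l1_norm_eq0.

Lemma linf_norm_ge0 (x : linf_sum) : 0 <= linf_norm x.
Proof. exact: bigmax_ge_id. Qed.

Lemma le_linf_norm (x : linf_sum) i : `|x i| <= linf_norm x.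
Proof. exact: le_bigmax. Qed.

Lemma linf_norm_le (x : linf_sum) M : 0 <= M -> (forall i, `|x i| <= M) -> linf_norm x <= M.
Proof. by move=> M0 xM; apply: bigmax_le => // i _; exact: xM. Qed.

Let linf_normD (x y : linf_sum) : linf_norm (x + y) <= linf_norm x + linf_norm y.
Proof.
apply: linf_norm_le => [|i]; first by rewrite addr_ge0 ?linf_norm_ge0.
by rewrite fin_prodD (le_trans (ler_normD _ _)) // lerD ?le_linf_norm.
Qed.

Let linf_normZ a (x : linf_sum) : linf_norm (a *: x) = `|a| * linf_norm x.
Proof.
have le b y : linf_norm (b *: y) <= `|b| * linf_norm y.
  apply: linf_norm_le => [|i]; first by rewrite mulr_ge0 ?linf_norm_ge0.
  by rewrite fin_prodZ normrZ ler_wpM2l ?le_linf_norm.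
apply/eqP; rewrite eq_le le /=; have [->|a0] := eqVneq a 0.
  by rewrite normr0 mul0r linf_norm_ge0.
by rewrite -ler_pdivlMl ?normr_gt0 // -normfV -{1}[x](scalerK a0).
Qed.

Let linf_norm_eq0 (x : linf_sum) : linf_norm x = 0 -> x = 0.
Proof.
move=> x0; apply/ffunP => i; rewrite fin_prod0; apply/normr0_eq0/le_anti.
by rewrite normr_ge0 andbT -x0 le_linf_norm.
Qed.

HB.instance Definition _ :=
  Lmodule_isNormed.Build R linf_sum linf_normD linf_normZ linf_norm_eq0.

Lemma l1_normE (x : l1_sum) : `|x| = \sum_i `|x i|. Proof. by []. Qed.

Lemma linf_normE (x : linf_sum) : `|x| = \big[Num.max/0]_i `|x i|.
Proof. by []. Qed.

Lemma linf_norm_le_l1 (x : linf_sum) : `|x| <= l1_norm x.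
Proof.
by apply: linf_norm_le => [|i]; [rewrite sumr_ge0|exact: (@le_l1_norm x)].
Qed.

End Sums.

Section Completeness.
Context {R : realType} {n : nat} (X : 'I_n -> completeNormedModType R).

Let complete_between (V : normedModType R) (p : forall i, V -> X i)
    (q : fin_prod (fun i => X i) -> V) :
  (forall i x y, `|p i x - p i y| <= `|x - y|) ->
  (forall y x, `|q y - x| <= \sum_i `|y i - p i x|) ->
  forall F : set_system V, ProperFilter F -> cauchy F -> cvg F.
Proof.
move=> plip qle F FF Fc.
have pcvg i : cvg (p i @ F).
  apply: cauchy_cvg; apply: cauchy_exP => e e0.
  have /cauchyP/(_ e e0)[x xF] := Fc.
  exists (p i x); change (F [set y | ball (p i x) e (p i y)]).
  apply: filterS xF => y /=.
  by rewrite -!ball_normE /ball_ /=; exact/le_lt_trans/plip.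
pose l : fin_prod (fun i => X i) := [ffun i => lim (p i @ F)].
apply/cvg_ex; exists (q l); apply/cvgrPdist_le => e e0.
have en0 : 0 < e / n.+1%:R by rewrite divr_gt0.
have near_l : \forall x \near F, forall i : 'I_n,
    `|l i - p i x| <= e / n.+1%:R.
  apply: filter_forall => i; rewrite /l ffunE.
  by move/cvgrPdist_le: (pcvg i); apply.
apply: filterS near_l => x lx; apply: (le_trans (qle l x)).
apply: (@le_trans _ _ (\sum_(i < n) e / n.+1%:R)); first exact: ler_sum.
rewrite sumr_const card_ord -[_ *+ n]mulr_natr mulrAC ler_pdivrMr //.
by rewrite ler_pM2l // ler_nat leqnSn.
Qed.

Let l1_complete : forall F : set_system (l1_sum (fun i => X i)),
  ProperFilter F -> cauchy F -> cvg F.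
Proof.
apply: (@complete_between _ (fun i (x : l1_sum (fun i => X i)) => x i) id)
  => [i x y|y x].
  by have := le_l1_norm (x - y) i; rewrite fin_prodD fin_prodN.
rewrite l1_normE; apply: ler_sum => i _.
by rewrite fin_prodD fin_prodN.
Qed.

HB.instance Definition _ :=
  Uniform_isComplete.Build (l1_sum (fun i => X i)) l1_complete.

Let linf_complete : forall F : set_system (linf_sum (fun i => X i)),
  ProperFilter F -> cauchy F -> cvg F.
Proof.
apply: (@complete_between _ (fun i (x : linf_sum (fun i => X i)) => x i) id)
  => [i x y|y x].
  by have := le_linf_norm (x - y) i; rewrite fin_prodD fin_prodN.
apply: (le_trans (linf_norm_le_l1 _)); apply: ler_sum => i _.
by rewrite fin_prodD fin_prodN.
Qed.

HB.instance Definition _ :=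
  Uniform_isComplete.Build (linf_sum (fun i => X i)) linf_complete.

End Completeness.

(* Main.v *)
Require Import Defs.
From HB Require Import structures.
From mathcomp Require Import all_boot all_order all_algebra.
From mathcomp Require Import all_classical all_reals all_analysis.
From mathcomp Require Import lra.

Set Implicit Arguments.
Unset Strict Implicit.
Unset Printing Implicit Defensive.

Import Order.TTheory GRing.Theory Num.Theory.
Import numFieldNormedType.Exports.

Local Open Scope classical_set_scope.
Local Open Scope ring_scope.

(** Let X** be the bidual and embed X in it by evaluation, isometrically by
the Hahn-Banach theorem.  The proof rests on a criterion ([nicely_smoothP]): X
is nicely smooth iff every nonzero Phi in X** is strictly closer to some x in X
than 0 is, |x - Phi| < |x|.  A proper closed subspace of X* is annihilated by
some Phi <> 0, and on the annihilator of Phi the functionals x and x - Phi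
agree, so |x - Phi| < |x| prevents that annihilator from norming x.
Conversely, if the kernel of Phi does not norm x, then a Hahn-Banach extension
Psi of the restriction of x to this kernel has |Psi| < |x|, and x - Psi is a
multiple of Phi, which is nonzero because |x| <> |Psi|; rescaling x gives the
inequality.

The dual of an l1-sum is the linf-sum of the duals and vice versa
([dual_l1_biproduct], [dual_linf_biproduct]), so the bidual of a sum is the sum
of the biduals, of the same type, and the criterion can be read coordinatewise:
- for the l1-sum, |x - Phi| < |x| says that the sum of the |x_i - Phi_i| is
  smaller than the sum of the |x_i|.  Choosing each x_i by the criterion (and
  x_i = 0 where Phi_i = 0) gives one direction; for Phi supported at one
  coordinate i the other terms cancel, which gives the converse;
- for the linf-sum, one x_i with Phi_i <> 0 suffices, because x_i can be
  replaced by a multiple whose norm exceeds |Phi|; and if Phi is supported at i,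
  then |x - Phi| < |x| forces the norm of x to be attained at coordinate i. *)

(** * The Hahn-Banach theorem *)

Section HahnBanach.
Context {R : realType} (V : lmodType R).
Implicit Types (p q : V -> R) (C : set (V * R)).

(** Homogeneity is only required as an inequality; equality, and [p 0 = 0],
follow by applying it to the inverse scalar. *)
Definition sublinear p :=
  (forall x y, p (x + y) <= p x + p y) /\
  (forall a x, 0 < a -> p (a *: x) <= a * p x).

(** A pair (w, r) in such a cone stands for the constraint f w <= r on an
unknown linear functional f. *)
Definition convex_cone C :=
  [/\ C 0, forall u v, C u -> C v -> C (u + v) &
      forall a u, 0 < a -> C u -> C (a *: (u : V * R^o))].

Lemma sublinearZ p a x : sublinear p -> 0 < a -> p (a *: x) = a * p x.
Proof.
move=> [_ pZ] a0; apply/le_anti; rewrite pZ //= -ler_pdivlMl //.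
by rewrite -{1}[x](scalerK (lt0r_neq0 a0)) pZ // invr_gt0.
Qed.

Lemma sublinear0 p : sublinear p -> p 0 = 0.
Proof.
by move=> sp; have := @sublinearZ p 2 0 sp ltac:(lra); rewrite scaler0; lra.
Qed.

Lemma sublinear_ge p x : sublinear p -> - p (- x) <= p x.
Proof.
by move=> sp; have := sp.1 x (- x); rewrite subrr sublinear0 //; lra.
Qed.

(** Lowering a sublinear functional along a cone of constraints: the infimum
below is the largest sublinear functional that is at most p and satisfies the
constraints. *)
Section Lowering.
Variables (p : V -> R) (C : set (V * R)).
Hypotheses (sp : sublinear p) (cC : convex_cone C).
Hypothesis pC : forall u, C u -> - u.2 <= p (- u.1).

Definition lowering x := inf [set p (x - u.1) + u.2 | u in C].

Let lower_bound x u : C u -> - p (- x) <= p (x - u.1) + u.2.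
Proof. by move=> /pC; have := sp.1 (- x) (x - u.1); rewrite addKr; lra. Qed.

Let le_lowering x u : C u -> lowering x <= p (x - u.1) + u.2.
Proof.
move=> Cu; apply: ge_inf; last by exists u.
by exists (- p (- x)) => _ [v Cv <-]; exact: lower_bound.
Qed.

Let lowering_ge x M :
  (forall u, C u -> M <= p (x - u.1) + u.2) -> M <= lowering x.
Proof.
move=> h; apply: lb_le_inf => [|_ [u Cu <-]]; last exact: h.
by have [C0 _ _] := cC; exists (p (x - 0) + 0), (0 : V * R).
Qed.

Lemma lowering_le x : lowering x <= p x.
Proof.
by have [C0 _ _] := cC; have := le_lowering x C0; rewrite subr0 addr0.
Qed.

Lemma lowering_cone u : C u -> lowering u.1 <= u.2.
Proof.
by move=> Cu; have := le_lowering u.1 Cu; rewrite subrr sublinear0 // add0r.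
Qed.

Lemma sublinear_lowering : sublinear lowering.
Proof.
have [C0 CD CZ] := cC; split=> [x y|a x a0].
  rewrite -lerBlDr; apply: lowering_ge => u Cu.
  rewrite lerBlDr -lerBlDl; apply: lowering_ge => v Cv.
  rewrite lerBlDl; apply: le_trans (le_lowering _ (CD _ _ Cu Cv)) _ => /=.
  by have := sp.1 (x - u.1) (y - v.1); rewrite opprD addrACA; lra.
rewrite mulrC -ler_pdivrMr //; apply: lowering_ge => u Cu.
rewrite ler_pdivrMr //; apply: le_trans (le_lowering _ (CZ a _ a0 Cu)) _ => /=.
by rewrite -scalerBr sublinearZ // -[a *: _]/(a * _) mulrDl !(mulrC a).
Qed.

End Lowering.

(** The constraint f (- x) <= - r, that is r <= f x, and its multiples. *)
Lemma ray_cone x r : convex_cone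
  [set (- (t *: x), - (t * r)) | t in [set t | 0 <= t]].
Proof.
split=> [|_ _ [s /= s0 <-] [t /= t0 <-]|a _ a0 [t /= t0 <-]].
- by exists 0 => //=; rewrite scale0r mul0r !oppr0.
- by exists (s + t); rewrite /= ?addr_ge0 // scalerDl mulrDl !opprD.
- exists (a * t); rewrite /= ?mulr_ge0 ?(ltW a0) //.
  congr (_, _); first by rewrite -scalerA -scalerN.
  by rewrite -mulrA -mulrN.
Qed.

(** Lowering p along the constraint p y <= f y gives a sublinear functional
below p, hence p itself by minimality; so p already satisfies the constraint
p (- y) <= - p y, and, adding x, it is superadditive. *)
Lemma minimal_sublinear_linear p : sublinear p ->
  (forall q, sublinear q -> (forall x, q x <= p x) -> forall x, p x <= q x) ->
  linear (p : V -> R^o).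
Proof.
move=> sp pmin.
have pD x y : p (x + y) = p x + p y.
  apply/le_anti; rewrite sp.1 /= addrC -lerBrDl.
  pose C := [set (- (t *: y), - (t * p y)) | t in [set t : R | 0 <= t]].
  have pC u : C u -> - u.2 <= p (- u.1).
    move=> [t /= t0 <-] /=; rewrite !opprK.
    move: t0; rewrite le_eqVlt => /predU1P[<-|t0].
      by rewrite scale0r mul0r sublinear0.
    by rewrite sublinearZ.
  have cC := ray_cone y (p y).
  have Cy : C (- y, - p y) by exists 1; rewrite /= ?scale1r ?mul1r.
  apply: (le_trans (pmin _ (sublinear_lowering sp cC pC)
                             (lowering_le sp cC pC) x)).
  rewrite -[x in leLHS](addrK y).
  apply: (le_trans ((sublinear_lowering sp cC pC).1 _ _)).
  by rewrite lerD ?(lowering_le sp cC pC) ?(lowering_cone sp pC Cy).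
have pN x : p (- x) = - p x.
  by apply/eqP; rewrite -addr_eq0 -pD addNr sublinear0.
have pZ a x : p (a *: x) = a * p x.
  have [a0|a0|->] := ltgtP a 0; last by rewrite scale0r mul0r sublinear0.
    by rewrite -[a]opprK scaleNr pN sublinearZ ?oppr_gt0 // !mulNr.
  by rewrite sublinearZ.
by move=> a x y; rewrite pD pZ.
Qed.

(** The pointwise infimum of the chain is finite because every sublinear q <= p
satisfies - p (- x) <= q x. *)
Lemma chain_inf_sublinear p (A : set (V -> R)) : A !=set0 ->
  (forall q, A q -> sublinear q /\ forall x, q x <= p x) ->
  total_on A (fun q r => forall x, r x <= q x) ->
  exists2 r, sublinear r & forall q, A q -> forall x, r x <= q x.
Proof.
move=> [q0 Aq0] Ap Atot; pose r x := inf [set q x | q in A].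
have r_le q x : A q -> r x <= q x.
  move=> Aq; apply: ge_inf; last by exists q.
  exists (- p (- x)) => _ [s /Ap[ss sp] <-].
  by apply: le_trans (sublinear_ge x ss); rewrite lerN2.
have inf_ge x M : (forall q, A q -> M <= q x) -> M <= r x.
  by move=> h; apply: lb_le_inf => [|_ [q Aq <-]]; [exists (q0 x), q0|exact: h].
exists r => [|q Aq x]; last exact: r_le.
split=> [x y|a x a0].
  rewrite -lerBlDr; apply: (inf_ge) => q Aq.
  rewrite lerBlDr -lerBlDl; apply: (inf_ge) => s As; rewrite lerBlDl.
  have [sq|qs] := Atot _ _ Aq As.
    apply: (le_trans (r_le _ _ As)); apply: (le_trans ((Ap _ As).1.1 _ _)).
    by rewrite lerD2r.
  apply: (le_trans (r_le _ _ Aq)); apply: (le_trans ((Ap _ Aq).1.1 _ _)).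
  by rewrite lerD2l.
rewrite mulrC -ler_pdivrMr //; apply: (inf_ge) => q Aq.
rewrite ler_pdivrMr // mulrC.
by apply: (le_trans (r_le _ _ Aq)); exact: (Ap _ Aq).1.2.
Qed.

Lemma sublinear_dominates_linear p : sublinear p ->
  exists2 f : V -> R^o, linear f & forall x, f x <= p x.
Proof.
move=> sp; pose T := {q : V -> R | sublinear q /\ forall x, q x <= p x}.
pose t0 : T := exist _ p (conj sp (fun x => lexx (p x))).
pose ge (q r : T) := `[< forall x, sval r x <= sval q x >].
have [||A Atot|[q [sq qp]] qmin] := ZL_preorder t0 (R := ge).
- by move=> q; apply/asboolP => x.
- move=> r q s /asboolP rq /asboolP qs; apply/asboolP => x.
  exact: le_trans (qs x) (rq x).
- have [->|/set0P[a Aa]] := eqVneq A set0; first by exists t0.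
  have [||_ _ [s As <-] [r Ar <-]|r sr rA] :=
    @chain_inf_sublinear p [set sval s | s in A].
  + by exists (sval a), a.
  + by move=> _ [s _ <-]; exact: (svalP s).
  + by have [/asboolP|/asboolP] := Atot _ _ As Ar; [left|right].
  have rp x : r x <= p x.
    by apply: le_trans (rA (sval a) _ x) ((svalP a).2 x); exists a.
  exists (exist _ r (conj sr rp)) => s As; apply/asboolP => x /=.
  by apply: rA; exists s.
- exists q => //; apply: minimal_sublinear_linear => // r sr rq.
  have rp x : r x <= p x by exact: le_trans (rq x) (qp x).
  apply/asboolP; apply: (qmin (exist _ r (conj sr rp))).
  exact/asboolP.
Qed.

(** This form covers at once the extension of a functional dominated on a
subspace (constraints given by its graph), the functionals that are large at a
given point, and those that vanish on a subspace but not at a given point. *)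
Theorem hahn_banach_cone p C : sublinear p -> convex_cone C ->
  (forall u, C u -> - u.2 <= p (- u.1)) ->
  exists f : V -> R^o, [/\ linear f, forall x, f x <= p x &
    forall u, C u -> f u.1 <= u.2].
Proof.
move=> sp cC pC.
have [f lf fq] := sublinear_dominates_linear (sublinear_lowering sp cC pC).
exists f; split=> // [x|u Cu]; apply: (le_trans (fq _)).
  exact: lowering_le.
exact: (lowering_cone sp pC).
Qed.

End HahnBanach.
(** * Duals, adjoints and the bidual *)

Section Duality.
Context {R : realType}.
Implicit Types V W : normedModType R.

Record contraction V W := Contraction {
  contraction_fun :> V -> W;
  contraction_linear : linear contraction_fun;
  contraction_le : forall x, `|contraction_fun x| <= `|x| }.

HB.instance Definition _ V W (T : contraction V W) :=
  GRing.isLinear.Build R V W *:%R (T : V -> W) (@contraction_linear V W T).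

Lemma dual_sum V I (r : seq I) (P : pred I) (f : I -> dual V) x :
  (\sum_(i <- r | P i) f i) x = \sum_(i <- r | P i) f i x.
Proof. by apply: (big_morph (fun g : dual V => g x)) => // g h. Qed.

Lemma dualN V (f : dual V) x : (- f) x = - f x.
Proof. by []. Qed.

Lemma dual_evalN V (f : dual V) x : f (- x) = - f x.
Proof. exact: linearN. Qed.

Lemma dual_ext V (f g : dual V) : (forall x, f x = g x) -> f = g.
Proof. by move=> fg; apply/val_inj/funext. Qed.

Lemma bounded_linear_dual_pred V (f : V -> R^o) M : linear f ->
  (forall x, f x <= M * `|x|) -> f \in @dual_pred R V.
Proof.
move=> lf fM; apply/dual_predP; split=> //.
pose F : {linear V -> R^o} := HB.pack_for {linear V -> R^o} f
  (GRing.isLinear.Build R V R^o *:%R f lf).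
have FM x : `|F x| <= M * `|x|.
  by rewrite ler_norml fM andbT lerNl -linearN (le_trans (fM _)) // normrN.
apply/(linear_bounded_continuous F)/linear_boundedP.
near=> r => x; apply: (le_trans (FM x)); apply: ler_wpM2r => //.
Unshelve. all: by end_near.
Qed.

Lemma dual_norm_bound V (f : dual V) M : 0 <= M ->
  (forall x, f x <= M * `|x|) -> `|f| <= M.
Proof.
move=> M0 fM; apply: dual_norm_le => x x1; apply: (@le_trans _ _ (M * `|x|)).
  by rewrite ler_norml fM andbT lerNl -linearN (le_trans (fM _)) // normrN.
by rewrite ler_piMr.
Qed.

Lemma dual_bound V (f : dual V) x : f x <= `|f| * `|x|.
Proof. exact: le_trans (ler_norm _) (le_dual_norm f x). Qed.

Section Adjoint.
Variables (V W : normedModType R) (T : contraction V W).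

Lemma comp_contraction_le (g : dual W) x : g (T x) <= `|g| * `|x|.
Proof.
by apply: (le_trans (dual_bound g _)); rewrite ler_wpM2l ?contraction_le.
Qed.

Lemma comp_contraction_dual_pred (g : dual W) :
  (fun x => g (T x)) \in @dual_pred R V.
Proof.
apply: (@bounded_linear_dual_pred _ _ `|g|) => [a x y|x].
  by rewrite !linearP.
exact: comp_contraction_le.
Qed.

Definition precomp (g : dual W) : dual V := Dual (comp_contraction_dual_pred g).

Lemma precomp_linear : linear precomp.
Proof. by move=> a f g; apply: dual_ext => x. Qed.

Lemma precomp_le (g : dual W) : `|precomp g| <= `|g|.
Proof. by apply: dual_norm_bound => // x; exact: comp_contraction_le. Qed.

Definition adjoint : contraction (dual W) (dual V) :=
  Contraction precomp_linear precomp_le.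

Lemma adjointE g x : adjoint g x = g (T x).
Proof. by []. Qed.

End Adjoint.

Section Evaluation.
Variable V : normedModType R.

Lemma eval_dual_pred (x : V) : (fun f : dual V => f x) \in @dual_pred R (dual V).
Proof.
apply: (@bounded_linear_dual_pred _ _ `|x|) => [a f g //|f].
by rewrite mulrC dual_bound.
Qed.

Definition bidual_eval (x : V) : dual (dual V) := Dual (eval_dual_pred x).

Lemma bidual_eval_linear : linear bidual_eval.
Proof. by move=> a x y; apply: dual_ext => f /=; rewrite linearP. Qed.

Lemma bidual_eval_le x : `|bidual_eval x| <= `|x|.
Proof.
by apply: dual_norm_bound => // f; rewrite mulrC; exact: (dual_bound f x).
Qed.

Definition bidual_embed : contraction V (dual (dual V)) :=
  Contraction bidual_eval_linear bidual_eval_le.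

Lemma bidual_embedE x f : bidual_embed x f = f x.
Proof. by []. Qed.

End Evaluation.

Lemma adjoint_adjoint_embed V W (T : contraction V W) x :
  adjoint (adjoint T) (bidual_embed V x) = bidual_embed W (T x).
Proof. by apply: dual_ext. Qed.

Lemma scaled_norm_sublinear V (M : R) : 0 <= M ->
  sublinear (fun x : V => M * `|x|).
Proof.
move=> M0; split=> [x y|a x a0]; first by rewrite -mulrDr ler_wpM2l ?ler_normD.
by rewrite normrZ gtr0_norm // mulrCA.
Qed.

Lemma hahn_banach_dual V (M : R) (C : set (V * R)) : 0 <= M -> convex_cone C ->
  (forall u, C u -> - u.2 <= M * `|u.1|) ->
  exists2 f : dual V, `|f| <= M & forall u, C u -> f u.1 <= u.2.
Proof.
move=> M0 cC CM.
have [|f [lf fM fC]] := hahn_banach_cone (scaled_norm_sublinear V M0) cC.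
  by move=> u /CM; rewrite normrN.
pose g := Dual (bounded_linear_dual_pred lf fM).
by exists g => //; exact: dual_norm_bound.
Qed.

(** A functional of norm at most 1 that is at least |x| at x is provided by the
constraint cone of the ray through x. *)
Lemma norm_bidual_embed V (x : V) : `|bidual_embed V x| = `|x|.
Proof.
apply/le_anti; rewrite contraction_le /=.
have [_ [t /= t0 <-] /=|f f1 fx] :=
  hahn_banach_dual ler01 (ray_cone x `|x|).
  by rewrite opprK normrN normrZ mul1r ger0_norm.
have : `|x| <= f x.
  have := fx (- x, - `|x|); rewrite linearN lerN2; apply.
  by exists 1; rewrite /= ?scale1r ?mul1r.
move=> /le_trans; apply; rewrite -bidual_embedE.
by apply: (le_trans (dual_bound _ f)); rewrite ler_piMr.
Qed.

(** If d is a lower bound of the distance from g to F, the constraints f w <= 0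
for w in F and f g >= d are compatible with the norm. *)
Lemma closed_subspace_separation V (F : set V) (g : V) :
  submod_closed (mem F) -> closed F -> ~ F g ->
  exists2 f : dual V, forall w, F w -> f w = 0 & f g != 0.
Proof.
move=> [F0 FL] clF Fg.
have F_ a u v : F u -> F v -> F (a *: u + v).
  by move=> Fu Fv; have := FL a u v; rewrite !inE; apply.
have [d d0 dF] : exists2 d : R, 0 < d & forall w, F w -> d <= `|g - w|.
  have : nbhs g (~` F) by apply: open_nbhs_nbhs; split=> //; exact: closed_openC.
  move=> /nbhs_ballP[d /= d0 dF]; exists d => // w Fw.
  by rewrite leNgt; apply/negP => wd; apply: (dF w) => //; rewrite -ball_normE.
pose C := [set (w - t *: g, - (t * d)) | w in F & t in [set t : R | 0 <= t]].
have {}F0 : F 0 by move: F0; rewrite inE.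
have cC : convex_cone C.
  split.
  - by exists 0 => //; exists 0 => //=; rewrite scale0r mul0r subrr oppr0.
  - move=> _ _ [w Fw [s /= s0 <-]] [v Fv [t /= t0 <-]].
    exists (w + v); first by rewrite -[w]scale1r; exact: F_.
    exists (s + t); rewrite /= ?addr_ge0 //.
    by rewrite scalerDl mulrDl !opprD addrACA.
  - move=> a _ a0 [w Fw [t /= t0 <-]].
    exists (a *: w); first by rewrite -[_ *: w]addr0; exact: F_.
    exists (a * t); rewrite /= ?mulr_ge0 ?(ltW a0) //.
    by congr (_, _); rewrite ?scalerBr ?scalerA // -mulrA -mulrN.
have CM u : C u -> - u.2 <= 1 * `|u.1|.
  move=> [w Fw [t /= t0 <-]] /=; rewrite opprK mul1r.
  move: t0; rewrite le_eqVlt => /predU1P[<-|t0]; first by rewrite mul0r.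
  rewrite -normrN opprB -[w](scalerKV (lt0r_neq0 t0)) -scalerBr normrZ.
  rewrite gtr0_norm // ler_pM2l // dF // -[_ *: _]addr0; exact: F_.
have [f _ fC] := hahn_banach_dual ler01 cC CM.
have fF w : F w -> f w <= 0.
  move=> Fw; have := fC (w, 0); apply; exists w => //.
  by exists 0; rewrite /= ?scale0r ?mul0r ?subr0 ?oppr0.
exists f => [w Fw|].
  apply/le_anti; rewrite fF //= -oppr_le0 -linearN fF //.
  by rewrite -scaleN1r -[_ *: w]addr0; exact: F_.
have : f (- g) <= - d.
  have := fC (- g, - d); apply; exists 0 => //.
  by exists 1; rewrite /= ?scale1r ?mul1r ?sub0r.
by rewrite linearN lerN2 => /(lt_le_trans d0) /lt0r_neq0.
Qed.

Lemma dual_norm_approx V (f : dual V) e : 0 < e ->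
  exists2 x, `|x| <= 1 & `|f| - e <= f x.
Proof.
move=> e0; have [_ [x /= x1 <-] fx] := sup_adherent e0 (dual_norm_has_sup f).
have [fx0|fx0] := leP 0 (f x).
  by exists x => //; rewrite -(ger0_norm fx0) ltW.
by exists (- x); rewrite ?normrN // linearN -(ltr0_norm fx0) ltW.
Qed.

End Duality.
(** * Nice smoothness in terms of the bidual *)

Section Criterion.
Context {R : realType}.

Lemma norming_set_le (V : normedModType R) (A : set (dual V)) x (c : R) :
  norming_set A -> (forall f, A f -> f x <= c) -> `|x| <= c.
Proof.
move=> [_ nA] fc; rewrite -lee_fin nA; apply: ge_ereal_sup => _ [f Af <-].
by rewrite lee_fin fc.
Qed.

(** The bound c may be taken real and nonnegative because 0 in A makes the
extended supremum nonnegative. *)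
Lemma norming_setP (V : normedModType R) (A : set (dual V)) :
  A 0 -> A `<=` @dual_unit_ball R V ->
  (forall x (c : R), 0 <= c -> (forall f, A f -> f x <= c) -> `|x| <= c) ->
  norming_set A.
Proof.
move=> A0 A1 Ac; split=> // x; apply/le_anti/andP; split; last first.
  apply: ge_ereal_sup => _ [f Af <-]; rewrite lee_fin.
  by apply: (le_trans (dual_bound f x)); rewrite ler_piMl ?A1.
set s := ereal_sup _.
have s_ge f : A f -> ((f x)%:E <= s)%E.
  by move=> Af; apply: ereal_sup_ubound; exists f.
have s0 : (0 <= s)%E by exact: s_ge A0.
case: s s0 s_ge => [c c0 fc|_ _|//]; last by rewrite leey.
by rewrite lee_fin; apply: Ac => // f Af; rewrite -lee_fin fc.
Qed.

Lemma kernel_closed_subspace (V : normedModType R) (Phi : dual (dual V)) :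
  closed_subspace [set f | Phi f = 0].
Proof.
split.
  split=> [|a f g]; rewrite !inE /=; first by rewrite linear0.
  by move=> f0 g0; rewrite (dual_linear Phi) f0 g0 scaler0 addr0.
apply: (@closed_comp _ _ Phi [set 0]); last exact: closed_eq.
by move=> f _; exact: dual_continuous.
Qed.

Lemma graph_cone (V : lmodType R) (W : set V) (l : {linear V -> R^o}) :
  submod_closed (mem W) -> convex_cone [set (w, l w : R) | w in W].
Proof.
move=> [W0 WL]; rewrite inE in W0.
have WL' a u v : W u -> W v -> W (a *: u + v).
  by move=> Wu Wv; have := WL a u v; rewrite !inE; apply.
split=> [|_ _ [u Wu <-] [v Wv <-]|a _ a0 [u Wu <-]].
- by exists 0; rewrite ?linear0.
- exists (u + v); last by rewrite linearD.
  by rewrite -[u]scale1r; exact: WL'.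
- exists (a *: u); last by rewrite linearZ.
  by rewrite -[_ *: u]addr0; exact: WL'.
Qed.

Lemma kernel_scalar (V : lmodType R) (phi psi : {linear V -> R^o}) f0 :
  phi f0 != 0 -> (forall f, phi f = 0 -> psi f = 0) ->
  forall f, psi f = psi f0 / phi f0 * phi f.
Proof.
move=> phi0 ker f.
have subE (l : {linear V -> R^o}) a : l (f - a *: f0) = l f - a * l f0.
  by rewrite linearB linearZ.
have := ker (f - (phi f / phi f0) *: f0).
rewrite !subE divfK // subrr => /(_ erefl)/eqP; rewrite subr_eq0 => /eqP ->.
by rewrite mulrC mulrA mulrAC.
Qed.

(** The kernel of Phi is the subspace to consider: it is norming exactly when
Phi does not come strictly closer than 0 to any x in X. *)
Lemma nicely_smoothP (X : completeNormedModType R) :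
  nicely_smooth X <-> forall Phi : dual (dual X), Phi != 0 ->
    exists x, `|bidual_embed X x - Phi| < `|x|.
Proof.
split=> [Xs Phi Phi0|H [F [[[Fsub Fcl] Fnorming] [_ nF]]]].
  apply/not_existsP => far; apply: Xs; exists [set f | Phi f = 0].
  have [f0 /eqP Phif0] : exists f, Phi f <> 0.
    apply/existsNP => Phi_eq0; move/eqP: Phi0; apply.
    by apply: dual_ext => f; rewrite Phi_eq0.
  have kerP := kernel_closed_subspace Phi.
  split; last by split=> // /(_ f0 I) /= /eqP; exact/negP.
  split=> //; apply: norming_setP => [|f []//|x c c0 xc].
    by split; rewrite /= /dual_unit_ball /= ?linear0 ?normr0.
  rewrite leNgt; apply/negP => cx.
  (* By homogeneity, the bound extends from the unit ball of the kernel. *)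
  have Phi_le f : Phi f = 0 -> f x <= c * `|f|.
    have [->|fn0 Phif] := eqVneq f 0; first by rewrite normr0 mulr0.
    have fp : 0 < `|f| by rewrite normr_gt0.
    rewrite -ler_pdivrMr // mulrC; apply: (xc (`|f|^-1 *: f)); split=> /=.
      by rewrite linearZ /= Phif scaler0.
    by rewrite /dual_unit_ball /= normrZ normfV normr_id mulVf ?gt_eqF.
  (* Psi agrees with x on the kernel of Phi and has norm at most c < |x|. *)
  have [u [f /= Phif <-] /=|Psi Psic Psix] :=
    hahn_banach_dual c0 (graph_cone (bidual_embed X x) kerP.1).
    by have := Phi_le (- f); rewrite dual_evalN Phif oppr0 normrN; apply.
  have Psi_ker f : Phi f = 0 -> (bidual_embed X x - Psi) f = 0.
    have le g : Phi g = 0 -> Psi g <= g x.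
      by move=> Phig; apply: (Psix (g, g x)); exists g.
    move=> Phif; rewrite dualD dualN bidual_embedE; apply/eqP.
    rewrite subr_eq0 eq_le le // andbT -lerN2.
    by have := le (- f); rewrite !dual_evalN Phif oppr0; apply.
  pose t := (bidual_embed X x - Psi) f0 / Phi f0.
  have PsiE : bidual_embed X x - Psi = t *: Phi.
    by apply: dual_ext => f; rewrite dualZ; exact: (kernel_scalar Phif0 Psi_ker).
  have [t0|t0] := eqVneq t 0.
    move/eqP: PsiE; rewrite t0 scale0r subr_eq0 => /eqP PsiE.
    by move: cx; rewrite -norm_bidual_embed PsiE ltNge Psic.
  (* Dividing x - Psi = t Phi by t: x / t is closer to Phi than to 0. *)
  apply: (far (t^-1 *: x)).
  have -> : bidual_embed X (t^-1 *: x) - Phi = t^-1 *: Psi.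
    rewrite linearZ /= -[Phi in LHS](scalerK t0) -PsiE -scalerBr.
    by rewrite opprB addrC subrK.
  by rewrite !normrZ ltr_pM2l ?normr_gt0 ?invr_eq0 // (le_lt_trans Psic).
have [g Fg] : exists g, ~ F g.
  by apply/existsNP => FT; apply: nF => g _; exact: contrapT (FT g).
have [Phi PhiF Phig] := closed_subspace_separation Fsub Fcl Fg.
have [|x] := H Phi; first by apply: contraNneq Phig => ->.
rewrite ltNge => /negP; apply; apply: (norming_set_le Fnorming) => f [Ff f1].
apply: (@le_trans _ _ ((bidual_embed X x - Phi) f)).
  by rewrite dualD dualN PhiF // subr0.
by apply: (le_trans (dual_bound _ _)); rewrite ler_piMr.
Qed.

End Criterion.
Lemma dep_choice I (T : I -> Type) (P : forall i, T i -> Prop) :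
  (forall i, exists x, P i x) -> exists f, forall i, P i (f i).
Proof.
by move=> h; exists (fun i => sval (cid (h i))) => i; exact: (svalP (cid (h i))).
Qed.

(** * Finite direct sums and their duals *)

Section Biproduct.
Context {R : realType} {n : nat}.

(** A direct sum decomposition with contractive injections and projections.
Working with the maps rather than with tuples makes the decomposition inherited
by the dual, through adjoints, with the roles of the two families exchanged. *)
Record biproduct (X : 'I_n -> normedModType R) (S : normedModType R) :=
  Biproduct {
    inj : forall i, contraction (X i) S;
    proj : forall i, contraction S (X i);
    injK : forall i x, proj i (inj i x) = x;
    proj_inj0 : forall i j x, i != j -> proj j (inj i x) = 0;
    sum_inj_proj : forall x, \sum_i inj i (proj i x) = x }.

Definition l1_biproduct X S (B : biproduct X S) :=
  forall x, `|x| = \sum_i `|proj B i x|.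

Definition linf_biproduct X S (B : biproduct X S) :=
  forall x, `|x| = \big[Num.max/0]_i `|proj B i x|.

Section Theory.
Variables (X : 'I_n -> normedModType R) (S : normedModType R).
Variable B : biproduct X S.

Lemma proj_sum (x : forall i, X i) j : proj B j (\sum_i inj B i (x i)) = x j.
Proof.
rewrite linear_sum (bigD1 j) //= injK big1 ?addr0 // => i ij.
exact: proj_inj0.
Qed.

Lemma dual_sum_inj (f : dual S) x :
  f x = \sum_i adjoint (inj B i) f (proj B i x).
Proof. by rewrite -{1}(sum_inj_proj B x) linear_sum. Qed.

Definition dual_biproduct : biproduct (fun i => dual (X i)) (dual S).
Proof.
apply: (@Biproduct _ _ (fun i => adjoint (proj B i)) (fun i => adjoint (inj B i)))
  => [i f|i j f ij|f].
- by apply: dual_ext => x; rewrite !adjointE injK.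
- by apply: dual_ext => x; rewrite !adjointE proj_inj0 1?eq_sym // linear0.
- apply: dual_ext => x; rewrite [RHS]dual_sum_inj dual_sum.
  by apply: eq_bigr.
Defined.

Lemma dual_l1_biproduct : l1_biproduct B -> linf_biproduct dual_biproduct.
Proof.
move=> l1 f; apply/le_anti/andP; split; last first.
  by apply: bigmax_le => // i _; exact: contraction_le.
apply: dual_norm_bound => [|x]; first exact: bigmax_ge_id.
rewrite dual_sum_inj l1 mulr_sumr; apply: ler_sum => i _.
apply: (le_trans (dual_bound _ _)); rewrite ler_wpM2r //.
exact: (le_bigmax _ (fun i => `|adjoint (inj B i) f|)).
Qed.

(** For the lower bound on |f|, glue together points x_i of the unit balls at
which the components of f almost attain their norms: the glued point is still
in the unit ball. *)
Lemma dual_linf_biproduct : linf_biproduct B -> l1_biproduct dual_biproduct.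
Proof.
move=> linf f; apply/le_anti/andP; split.
  apply: dual_norm_bound => [|x]; first by rewrite sumr_ge0.
  rewrite dual_sum_inj mulr_suml; apply: ler_sum => i _.
  apply: (le_trans (dual_bound _ _)).
  by rewrite ler_wpM2l ?contraction_le.
apply/ler_addgt0Pr => e e0; have en0 : 0 < e / n.+1%:R by rewrite divr_gt0.
have /dep_choice [x xP] : forall i, exists x : X i, `|x| <= 1 /\
    `|adjoint (inj B i) f| - e / n.+1%:R <= adjoint (inj B i) f x.
  move=> i; have [x x1 fx] := dual_norm_approx (adjoint (inj B i) f) en0.
  by exists x.
pose y := \sum_i inj B i (x i).
have y1 : `|y| <= 1.
  by rewrite linf; apply: bigmax_le => // i _; rewrite proj_sum; case: (xP i).
have fy : f y <= `|f| by apply: (le_trans (dual_bound f y)); rewrite ler_piMr.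
apply: (@le_trans _ _ (\sum_i (adjoint (inj B i) f (x i) + e / n.+1%:R))).
  by apply: ler_sum => i _; rewrite -lerBlDr; case: (xP i).
rewrite big_split /= sumr_const card_ord lerD //.
  by rewrite (le_trans _ fy) // linear_sum.
rewrite -[_ *+ n]mulr_natr mulrAC ler_pdivrMr //.
by rewrite ler_pM2l // ler_nat leqnSn.
Qed.

End Theory.

(** * Nice smoothness of finite sums *)

Section Smooth.
Variables (X : 'I_n -> completeNormedModType R) (S : completeNormedModType R).
Variable B : biproduct (fun i => X i) S.

Let BB := dual_biproduct (dual_biproduct B).

Lemma proj_bidual_embed_sub i x (Phi : dual (dual S)) :
  proj BB i (bidual_embed S x - Phi) =
  bidual_embed (X i) (proj B i x) - proj BB i Phi.
Proof. by rewrite linearB; congr (_ - _); exact: adjoint_adjoint_embed. Qed.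

Lemma proj_bidual_neq0 (Phi : dual (dual S)) :
  Phi != 0 -> exists i, proj BB i Phi != 0.
Proof.
move=> Phi0; apply: contrapT => h; move/eqP: Phi0; apply.
rewrite -(sum_inj_proj BB Phi) big1 // => i _.
have [->|p0] := eqVneq (proj BB i Phi) 0; first by rewrite linear0.
by exfalso; apply: h; exists i.
Qed.

Lemma inj_bidual_neq0 i (Phi : dual (dual (X i))) :
  Phi != 0 -> inj BB i Phi != 0.
Proof. by apply: contra_neq => h; rewrite -(injK BB Phi) h linear0. Qed.

Lemma norm_proj_bidual_off i j x (Phi : dual (dual (X i))) : i != j ->
  `|proj BB j (bidual_embed S x - inj BB i Phi)| = `|proj B j x|.
Proof.
by move=> ij; rewrite proj_bidual_embed_sub proj_inj0 // subr0 norm_bidual_embed.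
Qed.

Lemma l1_biproduct_nicely_smooth : l1_biproduct B ->
  nicely_smooth S <-> forall i, nicely_smooth (X i).
Proof.
move=> l1; have l1BB : l1_biproduct BB.
  exact/dual_linf_biproduct/dual_l1_biproduct.
split=> [/nicely_smoothP Ss i|Xs]; apply/nicely_smoothP => Phi Phi0.
  have [x] := Ss _ (inj_bidual_neq0 Phi0).
  rewrite l1BB l1 (bigD1 i) // [ltRHS](bigD1 i) //.
  rewrite (eq_bigr (fun j => `|proj B j x|)) ?ltrD2r => [lt_i|j].
    by exists (proj B i x); rewrite proj_bidual_embed_sub injK in lt_i.
  by rewrite eq_sym => /norm_proj_bidual_off ->.
have [i Phi_i] := proj_bidual_neq0 Phi0.
have /dep_choice [x xP] : forall j, exists x : X j,
    `|bidual_embed (X j) x - proj BB j Phi| <= `|x| ?= iff (proj BB j Phi == 0).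
  move=> j; have [->|Phi_j] := eqVneq (proj BB j Phi) 0.
    by exists 0; rewrite linear0 subrr !normr0; split; rewrite ?eqxx.
  have [x xlt] := (nicely_smoothP (X j)).1 (Xs j) _ Phi_j.
  by exists x; split; [exact: ltW|rewrite lt_eqF].
exists (\sum_i inj B i (x i)); rewrite l1BB l1 (bigD1 i) // [ltRHS](bigD1 i) //.
rewrite ltr_leD //; last apply: ler_sum => j _;
  rewrite proj_bidual_embed_sub !proj_sum.
  by rewrite (lt_leif (xP i)).
exact: (xP j).1.
Qed.

(** Moving from x to (s + 1) x adds s |x| to |x| and at most s |x| to
|x - Phi|, so the strict inequality survives while the norm grows. *)
Lemma embed_scale_lt (V : normedModType R) x (Phi : dual (dual V)) (M : R) :
  `|bidual_embed V x - Phi| < `|x| ->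
  exists2 y, `|bidual_embed V y - Phi| < `|y| & M < `|y|.
Proof.
move=> xlt; have x0 : 0 < `|x| by exact: le_lt_trans xlt.
pose s := `|M| / `|x|; have s0 : 0 <= s by rewrite divr_ge0.
have nE : `|(s + 1) *: x| = `|M| + `|x|.
  by rewrite normrZ ger0_norm ?addr_ge0 // mulrDl mul1r divfK ?gt_eqF.
exists ((s + 1) *: x); last by rewrite nE; have := ler_norm M; lra.
rewrite nE scalerDl scale1r linearD -addrA (le_lt_trans (ler_normD _ _)) //.
by rewrite norm_bidual_embed normrZ ger0_norm // divfK ?gt_eqF // ltrD2l.
Qed.

Lemma linf_biproduct_nicely_smooth : linf_biproduct B ->
  nicely_smooth S <-> forall i, nicely_smooth (X i).
Proof.
move=> linf; have linfBB : linf_biproduct BB.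
  exact/dual_l1_biproduct/dual_linf_biproduct.
split=> [/nicely_smoothP Ss i|Xs]; apply/nicely_smoothP => Phi Phi0.
  have [x xlt] := Ss _ (inj_bidual_neq0 Phi0).
  have far j : i != j -> `|proj B j x| < `|x|.
    move=> ij; apply: le_lt_trans xlt.
    by rewrite -(norm_proj_bidual_off x Phi ij) contraction_le.
  (* The maximum defining |x| is not attained away from i. *)
  have xi : `|x| <= `|proj B i x|.
    rewrite leNgt; apply/negP => xi; suff : `|x| < `|x| by rewrite ltxx.
    rewrite {1}linf; apply: bigmax_lt => [|j _]; first exact: le_lt_trans xlt.
    by have [<-|/far] := eqVneq i j.
  exists (proj B i x); apply: lt_le_trans xi; apply: le_lt_trans xlt.
  have := contraction_le (proj BB i) (bidual_embed S x - inj BB i Phi).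
  by rewrite proj_bidual_embed_sub injK.
have [i Phi_i] := proj_bidual_neq0 Phi0.
have [x0 /(embed_scale_lt `|Phi|)[x xlt Phix]] :=
  (nicely_smoothP (X i)).1 (Xs i) _ Phi_i.
exists (inj B i x); apply: (@lt_le_trans _ _ `|x|); last first.
  by rewrite -{1}(injK B x) contraction_le.
rewrite linfBB; apply: bigmax_lt => [|j _]; first exact: le_lt_trans xlt.
rewrite proj_bidual_embed_sub; have [<-|ij] := eqVneq i j; first by rewrite injK.
rewrite proj_inj0 // linear0 sub0r normrN.
by apply: le_lt_trans Phix; exact: contraction_le.
Qed.

End Smooth.
End Biproduct.

(** * The two concrete sums *)

Section Sums.
Context {R : realType} {n : nat} (X : 'I_n -> normedModType R).

Definition coord_inj i (x : X i) : fin_prod (fun i => X i) :=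
  [ffun j => eqtype.dfwith (fun j => 0 : X j) x j].

Lemma coord_injE i (x : X i) : coord_inj x i = x.
Proof. by rewrite ffunE dfwith_in. Qed.

Lemma coord_inj0 i j (x : X i) : i != j -> coord_inj x j = 0.
Proof. by move=> ij; rewrite ffunE dfwith_out. Qed.

Lemma coord_inj_linear i : linear (@coord_inj i).
Proof.
move=> a x y; apply/ffunP => j; rewrite fin_prodD fin_prodZ.
have [<-|ij] := eqVneq i j; first by rewrite !coord_injE.
by rewrite !coord_inj0 // scaler0 addr0.
Qed.

Lemma coord_linear i : linear (fun x : fin_prod (fun i => X i) => x i).
Proof. by move=> a x y; rewrite fin_prodD fin_prodZ. Qed.

Lemma fin_prod_sum (I : Type) (r : seq I) (F : I -> fin_prod (fun i => X i)) j :
  (\sum_(i <- r) F i) j = \sum_(i <- r) F i j.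
Proof.
apply: (big_morph (fun x : fin_prod (fun i => X i) => x j)) => [x y|].
  exact: fin_prodD.
exact: fin_prod0.
Qed.

Lemma sum_coord_inj (x : fin_prod (fun i => X i)) : \sum_i coord_inj (x i) = x.
Proof.
apply/ffunP => j; rewrite fin_prod_sum (bigD1 j) //= coord_injE big1 ?addr0 //.
by move=> i ij; exact: coord_inj0.
Qed.

Lemma l1_coord_inj_le i (x : X i) : `|coord_inj x : l1_sum X| <= `|x|.
Proof.
rewrite l1_normE (bigD1 i) //= coord_injE big1 ?addr0 // => j ij.
by rewrite coord_inj0 1?eq_sym // normr0.
Qed.

Lemma linf_coord_inj_le i (x : X i) : `|coord_inj x : linf_sum X| <= `|x|.
Proof.
rewrite linf_normE; apply: bigmax_le => // j _.
have [<-|ij] := eqVneq i j; first by rewrite coord_injE.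
by rewrite coord_inj0 // normr0.
Qed.

Definition l1_sum_biproduct : biproduct X (l1_sum X) :=
  @Biproduct _ _ X (l1_sum X)
    (fun i => @Contraction R (X i) (l1_sum X) (@coord_inj i)
                (@coord_inj_linear i) (@l1_coord_inj_le i))
    (fun i => @Contraction R (l1_sum X) (X i) (fun x => x i)
                (@coord_linear i) (fun x => le_l1_norm x i))
    (@coord_injE) (@coord_inj0) (@sum_coord_inj).

Definition linf_sum_biproduct : biproduct X (linf_sum X) :=
  @Biproduct _ _ X (linf_sum X)
    (fun i => @Contraction R (X i) (linf_sum X) (@coord_inj i)
                (@coord_inj_linear i) (@linf_coord_inj_le i))
    (fun i => @Contraction R (linf_sum X) (X i) (fun x => x i)
                (@coord_linear i) (fun x => le_linf_norm x i))
    (@coord_injE) (@coord_inj0) (@sum_coord_inj).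

End Sums.

Theorem mainTheorem7 (R : realType) (n : nat) (n_gt0 : (0 < n)%N)
    (X : 'I_n -> completeNormedModType R) :
  (nicely_smooth (l1_sum (fun i => X i)) <-> forall i, nicely_smooth (X i)) /\
  (nicely_smooth (linf_sum (fun i => X i)) <-> forall i, nicely_smooth (X i)).
Proof.
split.
  exact: (@l1_biproduct_nicely_smooth _ _ X _ (l1_sum_biproduct (fun i => X i))).
exact: (@linf_biproduct_nicely_smooth _ _ X _
          (linf_sum_biproduct (fun i => X i))).
Qed.
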